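(* Let $P$ be a separative poset and let $\omega\colon P\to\mathsf{O}P$ be the map $x\mapsto\mathsf{O}(x)$. Then, up to isomorphism, $(\mathsf{O}P,\omega)$ is the unique separative fusion-completion of $P$ and the unique separative sum-completion of $P$; that is, $(\mathsf{O}P,\omega)$ is both a separative fusion-completion and a separative sum-completion of $P$, and for every separative fusion-completion or separative sum-completion $(M,e)$ of $P$ there is an order-isomorphism $h\colon \mathsf{O}P\to M$ with $h\circ\omega=e$.
   Context: In a poset $P$, two elements $x,y$ overlap, written $x\circ y$, if there is $z\in P$ with $z\le x$ and $z\le y$; they are disjoint, written $x\wr y$, if they do not overlap. A poset $P$ is separative if whenever $x\not\le y$ there is $z\le x$ with $z\wr y$. A map $f\colon P\to M$ of posets is an order-embedding if $x\le y\iff f(x)\le f(y)$. For $x\in P$ let $\mathsf{O}(x)=\{y\in P\mid x\circ y\}$, and for $A\subseteq P$ let $\mathsf{O}(A)=\bigcup\{\mathsf{O}(x)\mid x\in A\}$. Let $\mathsf{O}P=\{\mathsf{O}(A)\mid \varnothing\neq A\subseteq P\}$, ordered by inclusion. Let $\varnothing\ne A\subseteq P$ and $x\in P$. The element $x$ is a fusion of $A$ if for every $y\in P$: $y\circ x$ if and only if $y\circ z$ for some $z\in A$. The element $x$ is a sum of $A$ if $a\le x$ for all $a\in A$ and for every $y\le x$ there is $z\in A$ with $y\circ z$. A poset is fusion-complete (resp. sum-complete) if every nonempty subset has a fusion (resp. a sum). A map $f\colon P\to M$ is: $\circ$-reflecting if $f(x)\circ f(y)$ implies $x\circ y$; fusion-preserving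 if $f(x)$ is a fusion of $f(A)$ in $M$ whenever $x\in P$ is a fusion of $A\subseteq P$; fusion-dense (resp. sum-dense) if for every $m\in M$ there is $A\subseteq P$ such that $m$ is a fusion (resp. a sum) of $f(A)$ in $M$. A fusion-completion of $P$ is a pair $(M,e)$ where $M$ is a fusion-complete poset and $e\colon P\to M$ is a $\circ$-reflecting, fusion-preserving and fusion-dense order-embedding. A sum-completion of $P$ is a pair $(M,e)$ where $M$ is a sum-complete poset and $e\colon P\to M$ is a sum-dense order-embedding. A fusion- or sum-completion $(M,e)$ is called separative if $M$ is separative. *)

(* Defs.v *)
From HB Require Import structures.
From mathcomp Require Import all_boot all_order.
From mathcomp Require Import boolp classical_sets.

Set Implicit Arguments.
Unset Strict Implicit.
Unset Printing Implicit Defensive.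

Import Order.TTheory.
Local Open Scope classical_set_scope.
Local Open Scope order_scope.

Section Poset.
Context {d : Order.disp_t} {P : porderType d}.
Implicit Types (x y z : P) (A : set P).

Definition overlap x y : Prop := exists z, z <= x /\ z <= y.

Definition disjoint_elts x y : Prop := ~ overlap x y.

(* Fusions and sums are only defined for nonempty sets, hence the first clause;
   in particular the sets witnessing fusion- and sum-density below are
   nonempty. *)
Definition is_fusion A x : Prop :=
  A !=set0 /\ forall y, overlap y x <-> exists2 z, A z & overlap y z.

Definition is_sum A x : Prop :=
  [/\ A !=set0,
      forall a, A a -> a <= x &
      forall y, y <= x -> exists2 z, A z & overlap y z].

Definition overlaps x : set P := [set y | overlap x y].

Definition overlapsU A : set P := \bigcup_(x in A) overlaps x.

End Poset.

Section PosetProperties.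
Context {d : Order.disp_t}.
Variable P : porderType d.

Definition separative : Prop :=
  forall x y : P, ~~ (x <= y) -> exists2 z, z <= x & disjoint_elts z y.

Definition fusion_complete : Prop :=
  forall A : set P, A !=set0 -> exists x, is_fusion A x.

Definition sum_complete : Prop :=
  forall A : set P, A !=set0 -> exists x, is_sum A x.

Definition OP_set : set (set P) :=
  [set overlapsU A | A in [set A : set P | A !=set0]].

(* The elements of OP_set, as a poset under inclusion: the order is the one
   induced by the library's order on [set P], see [OP_leE]. *)
Definition OP : Type := {X : set P | X \in OP_set}.

HB.instance Definition _ := SubChoice.on OP.
HB.instance Definition _ :=
  [SubChoice_isSubPOrder of OP by <: with set_display].

Lemma OP_leE (X Y : OP) : (X <= Y) = `[< val X `<=` val Y >].
Proof. by []. Qed.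

Lemma overlaps_OP (x : P) : overlaps x \in OP_set.
Proof.
by apply/mem_set; exists [set x]; [exists x | exact: bigcup_set1].
Qed.

Definition omega (x : P) : OP := exist _ (overlaps x) (overlaps_OP x).

End PosetProperties.

Section Maps.
Context {d d' : Order.disp_t} {P : porderType d} {M : porderType d'}.
Implicit Types f e h : P -> M.

Definition order_embedding f : Prop := {mono f : x y / x <= y}.

Definition order_isomorphism h : Prop := bijective h /\ order_embedding h.

Definition overlap_reflecting f : Prop :=
  forall x y, overlap (f x) (f y) -> overlap x y.

Definition fusion_preserving f : Prop :=
  forall (A : set P) (x : P), is_fusion A x -> is_fusion (f @` A) (f x).

Definition fusion_dense f : Prop :=
  forall m : M, exists A : set P, is_fusion (f @` A) m.

Definition sum_dense f : Prop :=
  forall m : M, exists A : set P, is_sum (f @` A) m.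

Definition fusion_completion e : Prop :=
  [/\ fusion_complete M, overlap_reflecting e, fusion_preserving e,
      fusion_dense e & order_embedding e].

Definition sum_completion e : Prop :=
  [/\ sum_complete M, sum_dense e & order_embedding e].

Definition separative_fusion_completion e : Prop :=
  fusion_completion e /\ separative M.

Definition separative_sum_completion e : Prop :=
  sum_completion e /\ separative M.

End Maps.

(* Main.v *)
Require Import Defs.
From mathcomp Require Import all_boot all_order.
From mathcomp Require Import boolp classical_sets.

Import Order.TTheory.
Local Open Scope classical_set_scope.
Local Open Scope order_scope.

(** In any poset a sum is a fusion, and in a separative poset the converse
    holds ([separative_is_sum]); so it is enough to work with fusions.

    For existence, the key fact is that [omega x] overlaps an element [X] of
    [OP P] exactly when [x] belongs to [X] ([overlap_omega]). Hence [OP P] is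
    separative, and any nonempty union of elements of [OP P] is their fusion
    ([is_fusion_bigcup]), which gives completeness, density and preservation
    of fusions at once. Separativity of [P] is used only to see that [omega]
    is an order-embedding.

    For uniqueness, let [e : P -> M] be an order-embedding into a separative
    poset that is overlap-reflecting and fusion-dense, and let
    [trace m := [set x | overlap (e x) m]]. If [m] is a fusion of the image of
    [A], then [trace m] is the union of the sets [overlaps a] for [a] in [A]
    ([traceE]). So [trace] takes its values in [OP P], it sends [e x] to
    [omega x], and it is surjective when [M] is fusion-complete. It is an
    order-embedding because [M] is separative and below each element of [M]
    there is some [e a] ([trace_le]). The required isomorphism is the inverse
    of [trace]. A separative sum-completion also has these properties: density
    again puts some [e a] below each element of [M], so [e] reflects overlap
    ([sum_dense_reflecting]). *)

Section Overlap.
Context {d : Order.disp_t} {P : porderType d}.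
Implicit Types (x y z : P) (A : set P).

Lemma overlap_refl x : overlap x x.
Proof. by exists x. Qed.

Lemma overlapC {x y} : overlap x y -> overlap y x.
Proof. by move=> [z [zx zy]]; exists z. Qed.

Lemma le_overlap {x y} z : x <= y -> overlap z x -> overlap z y.
Proof. by move=> xy [w [wz wx]]; exists w; split=> //; apply: le_trans xy. Qed.

Lemma overlaps_le {x y} : x <= y -> overlaps x `<=` overlaps y.
Proof. by move=> xy z /overlapC /(le_overlap z xy) /overlapC. Qed.

Lemma is_sum_fusion A x : is_sum A x -> is_fusion A x.
Proof.
move=> [A0 ub ov]; split=> // y; split=> [[z [zy zx]]|[a Aa]].
  have [a Aa za] := ov z zx.
  by exists a => //; apply: (overlaps_le zy) za.
exact/le_overlap/ub.
Qed.

Lemma separative_is_sum A x : separative P -> is_fusion A x -> is_sum A x.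
Proof.
move=> sepP [A0 fx]; split=> // [a Aa|y yx].
  apply: contrapT => /negP /sepP [z za]; apply.
  by apply/fx; exists a => //; exists z.
by apply/fx; exists y.
Qed.

Lemma separative_overlaps_le x y :
  separative P -> overlaps x `<=` overlaps y -> x <= y.
Proof.
move=> sepP xy; apply: contrapT => /negP /sepP [z zx]; apply.
by apply: overlapC; apply: xy; exists z.
Qed.

End Overlap.

(** In a separative poset fusions are sums, so completeness and density with
    respect to fusions give the same with respect to sums. *)
Lemma separative_sum_completionW (d d' : Order.disp_t) (P : porderType d)
    (M : porderType d') (e : P -> M) :
  separative_fusion_completion e -> separative_sum_completion e.
Proof.
move=> [[cM _ _ de ee] sM]; split=> //; split=> // [A /cM [m]|m].
  by exists m; apply: separative_is_sum.
by have [A] := de m; exists A; apply: separative_is_sum.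
Qed.

Section OPTheory.
Context {d : Order.disp_t} {P : porderType d}.
Implicit Types (x y : P) (X Y : OP P).

Lemma OP_leP X Y : X <= Y <-> val X `<=` val Y.
Proof. by rewrite OP_leE; split=> /asboolP. Qed.

Lemma OP_overlapsU X : exists2 A : set P, A !=set0 & val X = overlapsU A.
Proof. by case: X => X /= /set_mem [A A0 <-]; exists A. Qed.

(** The witness from right to left: if [x] overlaps [a] in [A], with
    [X = overlapsU A], then [omega z] works for any [z] below [x] and [a]. *)
Lemma overlap_omega x X : overlap (omega x) X <-> val X x.
Proof.
have [A A0 XA] := OP_overlapsU X; split.
  move=> [Z [/OP_leP Zx /OP_leP ZX]].
  have [C [c Cc] ZC] := OP_overlapsU Z.
  have cZ w : overlap c w -> val Z w by rewrite ZC => cw; exists c.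
  have := ZX c (cZ c (overlap_refl c)); rewrite XA => -[a Aa [w [wa wc]]].
  have [v [vx vw]] : overlap x w by apply/Zx/cZ; exists w.
  by exists a => //; exists v; split=> //; apply: le_trans wa.
rewrite XA => -[a Aa [z [za zx]]]; exists (omega z); split; apply/OP_leP.
  exact: overlaps_le.
by rewrite XA => y zy; exists a => //; apply: (overlaps_le za).
Qed.

Lemma overlap_OP Y X : overlap Y X <-> exists2 x, omega x <= Y & val X x.
Proof.
split=> [[Z [ZY ZX]]|[x xY /overlap_omega xX]]; last first.
  exact: (overlaps_le xY) xX.
have [C [c Cc] ZC] := OP_overlapsU Z.
have cZ : omega c <= Z by apply/OP_leP; rewrite ZC => w cw; exists c.
exists c; first exact: le_trans ZY.
by apply/overlap_omega; exists (omega c); split=> //; apply: le_trans ZX.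
Qed.

Lemma is_fusion_bigcup (S : set (OP P)) X : S !=set0 ->
  val X = \bigcup_(Z in S) val Z -> is_fusion S X.
Proof.
move=> S0 XS; split=> // Y; split=> [/overlap_OP[x xY]|[Z SZ /overlap_OP[x xY Zx]]].
  by rewrite XS => -[Z SZ Zx]; exists Z => //; apply/overlap_OP; exists x.
by apply/overlap_OP; exists x => //; rewrite XS; exists Z.
Qed.

Lemma is_fusion_omega (A : set P) X : A !=set0 ->
  val X = overlapsU A -> is_fusion (@omega d P @` A) X.
Proof.
move=> [a Aa] XA; apply: is_fusion_bigcup; first by exists (omega a); exists a.
by rewrite XA bigcup_image.
Qed.

Lemma separative_OP : separative (OP P).
Proof.
move=> X Y /negP XY.
have [x Xx Yx] : exists2 x, val X x & ~ val Y x.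
  apply: contrapT => nXY; apply/XY/OP_leP => x Xx.
  by apply: contrapT => Yx; apply: nXY; exists x.
have [Z [Zx ZX]] := (overlap_omega x X).2 Xx.
exists Z => // ZY; apply/Yx/overlap_omega.
exact: (overlaps_le Zx) ZY.
Qed.

Lemma fusion_complete_OP : fusion_complete (OP P).
Proof.
(* The union of [S] must be exhibited as some [overlapsU B]; take for [B]
   the set of all [a] with [omega a] below a member of [S]. *)
move=> S [X0 SX0]; pose B := [set a | exists2 X, S X & omega a <= X].
have BE : overlapsU B = \bigcup_(X in S) val X.
  apply/seteqP; split=> [x [a [X SX /OP_leP aX] ax]|x [X SX Xx]].
    by exists X => //; apply: aX.
  have [A A0 XA] := OP_overlapsU X.
  have := Xx; rewrite XA => -[a Aa ax]; exists a => //; exists X => //.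
  by apply/OP_leP; rewrite XA => y ay; exists a.
have B0 : B !=set0.
  have [x xX _] := (overlap_OP X0 X0).1 (overlap_refl X0).
  by exists x; exists X0.
have UB : overlapsU B \in @OP_set d P by apply/mem_set; exists B.
exists (exist (fun Y : set P => Y \in @OP_set d P) _ UB).
by apply: is_fusion_bigcup; [exists X0 | exact: BE].
Qed.

Lemma omega_fusion_completion :
  separative P -> separative_fusion_completion (@omega d P).
Proof.
move=> sepP; split; last exact: separative_OP.
split.
- exact: fusion_complete_OP.
- by move=> x y /overlap_omega /overlapC.
- move=> A x [A0 fx]; apply: is_fusion_omega => //=.
  apply/seteqP; split=> y.
    by move/overlapC/fx => [a Aa /overlapC ay]; exists a.
  by move=> [a Aa /overlapC ay]; apply/overlapC/fx; exists a.
- move=> X; have [A A0 XA] := OP_overlapsU X.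
  by exists A; apply: is_fusion_omega.
- move=> x y; apply/idP/idP => [/OP_leP|xy]; last exact/OP_leP/overlaps_le.
  exact: separative_overlaps_le.
Qed.

End OPTheory.

Section Uniqueness.
Context {d d' : Order.disp_t} {P : porderType d} {M : porderType d'}.
Variable e : P -> M.

(** The set of elements of [P] whose image overlaps [m]. *)
Definition trace (m : M) : set P := [set x | overlap (e x) m].

Hypotheses (e_emb : order_embedding e).

Lemma sum_dense_reflecting : sum_dense e -> overlap_reflecting e.
Proof.
move=> de x y [m [mx my]]; have [A [[_ [a Aa _]] ub _]] := de m.
have am : e a <= m by apply: ub; exists a.
by exists a; rewrite -2!e_emb; split; apply: le_trans am _.
Qed.

Hypotheses (sepM : separative M) (e_refl : overlap_reflecting e).

Lemma embedding_overlap x y : overlap (e x) (e y) <-> overlap x y.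
Proof.
by split=> [/e_refl //|[z [zx zy]]]; exists (e z); rewrite !e_emb.
Qed.

Lemma traceE (A : set P) m : is_fusion (e @` A) m -> trace m = overlapsU A.
Proof.
move=> [_ fm]; apply/seteqP; split=> x.
  by move=> /fm [_ [a Aa <-] /e_refl /overlapC ax]; exists a.
move=> [a Aa /overlapC ax]; apply/fm; exists (e a); first by exists a.
exact/embedding_overlap.
Qed.

Lemma trace_emb x : trace (e x) = overlaps x.
Proof.
by apply/seteqP; split=> y; [move/embedding_overlap/overlapC |
  move=> xy; apply/embedding_overlap/overlapC].
Qed.

Hypothesis e_dense : fusion_dense e.

Lemma trace_OP m : trace m \in @OP_set d P.
Proof.
have [A fm] := e_dense m; rewrite (traceE A m fm); apply/mem_set; exists A => //.
by have [[_ [a Aa _]] _] := fm; exists a.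
Qed.

Lemma trace_le m n : trace m `<=` trace n <-> m <= n.
Proof.
split=> [mn|mn x]; last exact: le_overlap.
apply: contrapT => /negP /sepM [k km kn].
(* The fusion [k] of the image of some [A] is a sum, so that some [e a] lies
   below [k], hence is disjoint from [n] although it overlaps [m]. *)
have [A /(separative_is_sum _ _ sepM) [[_ [a Aa _]] ub _]] := e_dense k.
have ak : e a <= k by apply: ub; exists a.
have /mn an : trace m a by exists (e a); split=> //; apply: le_trans km.
by apply/kn; apply: (overlaps_le ak) an.
Qed.

Lemma OP_isomorphism : fusion_complete M ->
  exists h : OP P -> M, order_isomorphism h /\ forall x, h (omega x) = e x.
Proof.
move=> cM; pose g m : OP P := exist (fun Y : set P => Y \in @OP_set d P) _ (trace_OP m).
have g_emb m n : (g m <= g n) = (m <= n).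
  by apply/idP/idP => [/OP_leP/trace_le //|/trace_le mn]; apply/OP_leP.
have g_inj : injective g.
  by move=> m n mn; apply/eqP; rewrite eq_le -2!g_emb mn lexx.
have g_surj X : exists m, g m = X.
  have [A [a Aa] XA] := OP_overlapsU X.
  have [|m fm] := cM (e @` A); first by exists (e a); exists a.
  by exists m; apply: val_inj; rewrite XA; apply: traceE.
pose h X := projT1 (cid (g_surj X)).
have gh : cancel h g by move=> X; rewrite /h; case: cid.
have hg : cancel g h by move=> m; apply: g_inj.
exists h; split=> [|x]; first split.
- by exists g.
- by move=> X Y; rewrite -g_emb !gh.
- by apply: g_inj; rewrite gh; apply: val_inj; rewrite /= trace_emb.
Qed.

End Uniqueness.

Theorem theorem4p6 (d : Order.disp_t) (P : porderType d)
    (sepP : separative P) :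
  [/\ separative_fusion_completion (@omega d P),
      separative_sum_completion (@omega d P) &
      forall (d' : Order.disp_t) (M : porderType d') (e : P -> M),
        separative_fusion_completion e \/ separative_sum_completion e ->
        exists h : OP P -> M,
          order_isomorphism h /\ forall x : P, h (omega x) = e x].
Proof.
have fc := omega_fusion_completion sepP.
split=> // [|d' M e [[[cM re _ de ee] sM]|[[cM de ee] sM]]].
- exact: separative_sum_completionW.
- exact: OP_isomorphism.
- apply: OP_isomorphism => //; first exact: sum_dense_reflecting.
    by move=> m; have [A] := de m; exists A; apply: is_sum_fusion.
  by move=> A /cM [m]; exists m; apply: is_sum_fusion.
Qed.
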